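(* Let $f:\mathbb{R}^n\to\mathbb{R}$ be twice continuously differentiable, let $x^*$ satisfy $\nabla f(x^* )=0$, and suppose that the Hessian $H=H(x^* )$ of $f$ at $x^*$ is positive semidefinite, with largest eigenvalue $L$ and smallest nonzero eigenvalue $\ell$, where $L>\ell>0$; put $\bar\kappa=L/\ell$. For $\alpha>0$ let $q(x)=x-\alpha\nabla f(x)$, so that $q'(x^* )=I-\alpha H$, and for $\beta\in\mathbb{R}$ let $$T(x^*;\beta)=\begin{bmatrix}(1+\beta)q'(x^* )&-\beta q'(x^* )\\ I&0\end{bmatrix}$$ be the Jacobian matrix at $(x^*,x^* )$ of the iteration $x_{k+1}=(1+\beta)q(x_k)-\beta q(x_{k-1})$ written as a first-order system. Then the optimal asymptotic convergence factor of this iteration is $$\min_{\alpha>0,\ \beta\in\mathbb{R}}\rho\big(T(x^*;\beta)\big)=\frac{\sqrt{3\bar\kappa+1}-2}{\sqrt{3\bar\kappa+1}}=1-\sqrt{\frac{4\ell}{3L+\ell}}<1-\sqrt{\frac{\ell}{L}},$$ where the unique optimal $\alpha$ and $\beta$ are given by $$\alpha^*=\frac{4}{3L+\ell},\qquad \beta^*=\frac{1-\sqrt{\alpha^*\ell}}{1+\sqrt{\alpha^*\ell}}=\frac{\sqrt{3\bar\kappa+1}-2}{\sqrt{3\bar\kappa+1}+2}.$$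
   Context: The iteration $x_{k+1}=(1+\beta)q(x_k)-\beta q(x_{k-1})$ is stationary Anderson acceleration with window size one (sAA(1)) applied to steepest descent. The system form is $(x_k,x_{k-1})\mapsto((1+\beta)q(x_k)-\beta q(x_{k-1}),\,x_k)$, and its asymptotic convergence factor at $x^*$ is $\rho(T(x^*;\beta))$, which depends on both $\alpha$ (through $q'$) and $\beta$. Convention for $\rho$: if $H$ is positive definite, $\rho(T)$ is the usual spectral radius. If $H$ has a kernel of dimension $d>0$, then $T(x^*;\beta)$ has the eigenvalue $1$ as a consequence, and $\rho(T)$ denotes the largest modulus of the eigenvalues that remain after removing from the list of eigenvalues (counted with algebraic multiplicity) the $d$ copies of the eigenvalue $1$ that come from the kernel of $H$. *)

(* Defs.v *)
From HB Require Import structures.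
From mathcomp Require Import all_boot all_order all_algebra.
From mathcomp Require Import all_classical all_reals all_analysis.
From mathcomp Require Import complex.

Set Implicit Arguments.
Unset Strict Implicit.
Unset Printing Implicit Defensive.

Import Order.TTheory GRing.Theory Num.Theory.
Import numFieldNormedType.Exports.

Local Open Scope ring_scope.
Local Open Scope complex_scope.

Section Calculus.
Variable R : realType.

(* Points of R^n are row vectors and [jacobian] acts on them from the right,
   so it is the transpose of the usual matrix (d F_i / d x_j)_(i, j). *)
Definition Jacobian (n m : nat) (F : 'rV[R]_n -> 'rV[R]_m) (x : 'rV[R]_n) :
    'M[R]_(m, n) :=
  (jacobian F x)^T.

Definition gradient (n : nat) (f : 'rV[R]_n -> R) (x : 'rV[R]_n) : 'rV[R]_n :=
  \row_i 'D_(delta_mx 0 i) f x.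

Definition Hessian (n : nat) (f : 'rV[R]_n -> R) (x : 'rV[R]_n) : 'M[R]_n :=
  Jacobian (gradient f) x.

Definition twice_continuously_differentiable (n : nat) (f : 'rV[R]_n -> R) :
    Prop :=
  [/\ forall x, differentiable f x,
      forall x, differentiable (gradient f) x
    & continuous (Hessian f)].

End Calculus.

Section Spectrum.
Variable R : realType.

Definition positive_semidefinite (n : nat) (A : 'M[R]_n) : Prop :=
  A^T = A /\ forall v : 'rV[R]_n, 0 <= (v *m A *m v^T) 0 0.

Definition largest_eigenvalue (n : nat) (A : 'M[R]_n) (a : R) : Prop :=
  eigenvalue A a /\ forall b, eigenvalue A b -> b <= a.

Definition smallest_nonzero_eigenvalue (n : nat) (A : 'M[R]_n) (a : R) : Prop :=
  [/\ eigenvalue A a, a != 0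
    & forall b, eigenvalue A b -> b != 0 -> a <= b].

(* The complex roots of the characteristic polynomial, each repeated
   according to its algebraic multiplicity. *)
Definition eigenvalues (m : nat) (A : 'M[R]_m) : seq R[i] :=
  sval (closed_field_poly_normal (char_poly (map_mx (real_complex R) A))).

(* [iter d (rem 1)] deletes d occurrences of 1 from the list; for d = 0 this
   is the usual spectral radius. *)
Definition reduced_spectral_radius (d m : nat) (A : 'M[R]_m) : R :=
  \big[Num.max/0]_(z <- iter d (rem 1) (eigenvalues A)) Normc.normc z.

End Spectrum.

Section Iteration.
Variables (R : realType) (n : nat) (f : 'rV[R]_n -> R).

Definition steepest_descent (alpha : R) (x : 'rV[R]_n) : 'rV[R]_n :=
  x - alpha *: gradient f x.

(* A pair (x, y) of points of R^n is encoded as row_mx x y. *)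
Definition sAA1_system (alpha beta : R) (z : 'rV[R]_(n + n)) : 'rV[R]_(n + n) :=
  row_mx ((1 + beta) *: steepest_descent alpha (lsubmx z)
            - beta *: steepest_descent alpha (rsubmx z))
         (lsubmx z).

Definition sAA1_matrix (alpha beta : R) (x : 'rV[R]_n) : 'M[R]_(n + n) :=
  let q' := Jacobian (steepest_descent alpha) x in
  block_mx ((1 + beta) *: q') (- beta *: q') 1%:M 0.

Definition convergence_factor (alpha beta : R) (x : 'rV[R]_n) : R :=
  reduced_spectral_radius (\rank (kermx (Hessian f x)))
    (sAA1_matrix alpha beta x).

End Iteration.

(* Main.v *)
(* Diagonalizing the Hessian splits the characteristic polynomial of T into the
   factors z^2 - (1 + beta) m z + beta m with m = 1 - alpha h, one for each
   Hessian eigenvalue h; a zero eigenvalue contributes the roots 1 and beta.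
   Both roots of z^2 - b z + c with b, c real lie in the disk of radius r > 0 if
   and only if |c| <= r^2 and |b| r <= r^2 + c.  These conditions are convex in
   m, so only h = l and h = L matter.  With r = 1 - t and t^2 = 4 l / (3 L + l),
   they force 1 - alpha l = 1 - t^2 and beta = (1 - t) / (1 + t). *)

Require Import Defs.
From HB Require Import structures.
From mathcomp Require Import all_boot all_order all_algebra.
From mathcomp Require Import all_classical all_reals all_analysis.
From mathcomp Require Import complex spectral sesquilinear ring lra.
Set Implicit Arguments.
Unset Strict Implicit.
Unset Printing Implicit Defensive.
Import Order.TTheory GRing.Theory Num.Theory.
Import numFieldNormedType.Exports.
Local Open Scope ring_scope.

(** * Differentials of steepest descent and of the first-order system *)

Lemma continuous_row_mxl (R : realType) (n1 n2 : nat) :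
  continuous (fun u : 'rV[R]_n1 => row_mx u (0 : 'rV[R]_n2)).
Proof.
move=> u A /nbhs_ballP[e /= e0 eA].
apply/nbhs_ballP; exists e => //= v [_ uv]; apply: eA; split => // i j.
rewrite !mxE; case: (fintype.split j) => k; first exact: uv.
exact: ballxx.
Qed.

Lemma continuous_row_mxr (R : realType) (n1 n2 : nat) :
  continuous (row_mx (0 : 'rV[R]_n1) : 'rV[R]_n2 -> 'rV[R]_(n1 + n2)).
Proof.
move=> u A /nbhs_ballP[e /= e0 eA].
apply/nbhs_ballP; exists e => //= v [_ uv]; apply: eA; split => // i j.
rewrite !mxE; case: (fintype.split j) => k; last exact: uv.
exact: ballxx.
Qed.

Lemma is_diff_linear (R : realType) (V W : normedModType R)
    (g : V -> W) (x : V) :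
  linear g -> continuous g -> is_diff x g g.
Proof.
move=> g_lin g_cont; pose gM := GRing.isLinear.Build _ _ _ _ _ g_lin.
pose gL : {linear V -> W} := HB.pack g gM.
have gc : continuous gL by [].
apply: DiffDef; first exact: (linear_differentiable x gc).
exact: (diff_lin x gc).
Qed.

(** Concatenation is the sum of the two continuous linear embeddings [row_mx _ 0] and [row_mx 0 _],
    so the chain rule and additivity suffice. *)
Lemma is_diff_row_mx (R : realType) (V : normedModType R) (n1 n2 : nat)
    (u du : V -> 'rV[R]_n1) (v dv : V -> 'rV[R]_n2) (x : V) :
  is_diff x u du -> is_diff x v dv ->
  is_diff x (fun z => row_mx (u z) (v z)) (fun z => row_mx (du z) (dv z)).
Proof.
move=> udu vdv.
have row_mx_split (a : V -> 'rV[R]_n1) (b : V -> 'rV[R]_n2) :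
    (fun z => row_mx (a z) (b z))
      = ((fun y => row_mx y 0) \o a) + (row_mx 0 \o b).
  by apply/funext => z; rewrite [RHS]add_row_mx addr0 add0r.
rewrite !row_mx_split; apply: is_diffD; apply: is_diff_comp.
- apply: is_diff_linear; last exact: continuous_row_mxl.
  by move=> k y z; rewrite scale_row_mx add_row_mx scaler0 addr0.
- apply: is_diff_linear; last exact: continuous_row_mxr.
  by move=> k y z; rewrite scale_row_mx add_row_mx scaler0 addr0.
Qed.

Lemma Jacobian_is_diff (R : realType) (n m : nat) (F : 'rV[R]_n -> 'rV[R]_m)
    (x : 'rV[R]_n) (A : 'M[R]_(m, n)) :
  is_diff x F (fun v => v *m A^T) -> Jacobian F x = A.
Proof.
move=> dF; rewrite /Jacobian /jacobian -[RHS]trmxK; congr (_^T).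
by apply/row_matrixP => i; rewrite !rowE mul_rV_lin1 /= diff_val.
Qed.

Lemma is_diff_steepest_descent (R : realType) (n : nat) (f : 'rV[R]_n -> R)
    (alpha : R) (x : 'rV[R]_n) :
  differentiable (gradient f) x ->
  is_diff x (steepest_descent f alpha)
    (fun v => v *m (1%:M - alpha *: Hessian f x)^T).
Proof.
move=> df.
have dag : is_diff x (alpha *: gradient f)
    (alpha *: ('d (gradient f) x : _ -> _)).
  exact/is_diffZ/differentiableP.
have -> : (fun v => v *m (1%:M - alpha *: Hessian f x)^T)
    = id - alpha *: ('d (gradient f) x : _ -> _).
  apply/funext => v; rewrite /Hessian /Jacobian /jacobian.
  rewrite linearB linearZ /= trmx1 trmxK mulmxBr mulmx1 -scalemxAr.
  by rewrite mul_rV_lin1.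
exact: (is_diffB (is_diff_id x) dag).
Qed.

Lemma is_diff_sAA1_system (R : realType) (n : nat) (f : 'rV[R]_n -> R)
    (alpha beta : R) (x : 'rV[R]_n) :
  differentiable (gradient f) x ->
  is_diff (row_mx x x) (sAA1_system f alpha beta)
    (fun v => v *m (sAA1_matrix f alpha beta x)^T).
Proof.
move=> df; have sd := is_diff_steepest_descent alpha df.
pose q' := (1%:M - alpha *: Hessian f x)^T.
have dl : is_diff (row_mx x x) (lsubmx : 'rV[R]_(n + n) -> 'rV[R]_n) lsubmx.
  by apply: is_diff_linear; [exact: linearP|exact: continuous_lsubmx].
have dr : is_diff (row_mx x x) (rsubmx : 'rV[R]_(n + n) -> 'rV[R]_n) rsubmx.
  by apply: is_diff_linear; [exact: linearP|exact: continuous_rsubmx].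
have -> : (fun v : 'rV_(n + n) => v *m (sAA1_matrix f alpha beta x)^T)
    = (fun v => row_mx
         ((1 + beta) *: (lsubmx v *m q') - beta *: (rsubmx v *m q'))
         (lsubmx v)).
  apply/funext => v; rewrite /sAA1_matrix (Jacobian_is_diff sd).
  rewrite tr_block_mx -{1}[v]hsubmxK mul_row_block.
  rewrite trmx1 trmx0 mulmx1 mulmx0 addr0.
  have trZ k (A : 'M[R]_n) : (k *: A)^T = k *: A^T by exact: linearZ.
  by rewrite !trZ scaleNr mulmxN -!scalemxAr.
apply: is_diff_row_mx => //.
have sdl : is_diff (row_mx x x) (steepest_descent f alpha \o lsubmx)
    ((fun v => v *m q') \o lsubmx).
  by apply: is_diff_comp; rewrite row_mxKl.
have sdr : is_diff (row_mx x x) (steepest_descent f alpha \o rsubmx)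
    ((fun v => v *m q') \o rsubmx).
  by apply: is_diff_comp; rewrite row_mxKr.
exact: (is_diffB (is_diffZ (1 + beta) sdl) (is_diffZ beta sdr)).
Qed.

(** * Ranks, determinants and spectra of diagonalizable matrices *)

Lemma cardC_ord (n : nat) (p : pred 'I_n) : #|[predC p]| = (n - #|p|)%N.
Proof. by have := cardC p; rewrite card_ord => /(canRL (addKn _)). Qed.

Lemma rank_diag_mx_le (F : fieldType) (n : nat) (d : 'rV[F]_n) :
  (\rank (diag_mx d) <= #|[pred i | (d 0 i != 0)%R]|)%N.
Proof.
rewrite diag_mx_sum_delta (bigID (fun i : 'I_n => d 0 i != 0)) /=.
rewrite [X in _ + X]big1; last first.
  by move=> i; rewrite negbK => /eqP ->; rewrite scale0r.
rewrite addr0 -sum1_card; elim/big_ind2: _ => [|A a B b leA leB|i _].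
- by rewrite mxrank0.
- exact: leq_trans (mxrank_add _ _) (leq_add leA leB).
- by apply: leq_trans (mxrank_scale _ _) _; rewrite mxrank_delta.
Qed.

(** For the lower bound, put ones on the diagonal wherever [d] vanishes: the resulting sum is
    invertible, and subadditivity of the rank bounds [n] by the rank of [diag_mx d] plus the number
    of zeros of [d]. *)
Lemma rank_diag_mx (F : fieldType) (n : nat) (d : 'rV[F]_n) :
  \rank (diag_mx d) = #|[pred i | (d 0 i != 0)%R]|.
Proof.
apply/eqP; rewrite eqn_leq rank_diag_mx_le /=.
pose e : 'rV[F]_n := \row_i (d 0 i == 0)%:R.
have de_unit : diag_mx d + diag_mx e \in unitmx.
  rewrite -linearD unitmxE det_diag unitfE; apply/prodf_neq0 => i _.
  rewrite !mxE; have [->|d_neq0] := eqVneq (d 0 i) 0; last by rewrite addr0.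
  by rewrite add0r oner_eq0.
have e_card :
    #|[pred i | (e 0 i != 0)%R]| = (n - #|[pred i | (d 0 i != 0)%R]|)%N.
  rewrite -cardC_ord.
  apply: eq_card => i; rewrite !inE mxE negbK.
  by have [_|_] := eqVneq (d 0 i) 0; rewrite ?eqxx ?oner_eq0.
have d_card : (#|[pred i | (d 0 i != 0)%R]| <= n)%N.
  by rewrite -[leqRHS](card_ord n) max_card.
have := leq_trans (mxrank_add (diag_mx d) (diag_mx e))
  (leq_add (leqnn _) (rank_diag_mx_le e)).
rewrite mxrank_unit // e_card => n_le.
by rewrite -(leq_add2r (n - #|[pred i | (d 0 i != 0)%R]|)) subnKC.
Qed.

(** Conjugation by [P] commutes with polynomial combinations of the identity and the matrix. The
    lemma serves both for the Hessian, with [u] equal to ['X] and [v] to -1, and for the quadratic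
    matrix polynomial of the iteration. *)
Lemma det_lin_comb_conj_diag (F : fieldType) (n : nat) (P : 'M[F]_n)
    (d : 'rV[F]_n) (u v : {poly F}) : P \in unitmx ->
  \det (u%:M + v *: map_mx polyC (invmx P *m diag_mx d *m P))
    = \prod_i (u + v * (d 0 i)%:P).
Proof.
move=> P_unit; pose Q := map_mx (@polyC F) P.
pose Q' := map_mx (@polyC F) (invmx P).
have QQ : Q' *m Q = 1%:M by rewrite -map_mxM mulVmx // map_mx1.
have detQQ : \det Q' * \det Q = 1 by rewrite -det_mulmx QQ det1.
have -> : u%:M + v *: map_mx polyC (invmx P *m diag_mx d *m P)
    = Q' *m diag_mx (\row_i (u + v * (d 0 i)%:P)) *m Q.
  have -> : diag_mx (\row_i (u + v * (d 0 i)%:P))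
      = u%:M + v *: map_mx polyC (diag_mx d).
    apply/matrixP => i j; rewrite !mxE; case: eqP => _ /=.
      by rewrite !mulr1n.
    by rewrite !mulr0n mulr0 addr0.
  rewrite mulmxDr mulmxDl scalar_mxC -[u%:M *m _ *m _]mulmxA QQ mulmx1.
  by rewrite -scalemxAr -scalemxAl !map_mxM.
rewrite !det_mulmx det_diag mulrAC detQQ mul1r.
by apply: eq_bigr => i _; rewrite mxE.
Qed.

(* Companion linearization of the matrix polynomial [X^2 - X A + B]. *)
Lemma char_poly_second_order (F : fieldType) (n : nat) (A B : 'M[F]_n) :
  char_poly (block_mx A (- B) 1%:M 0)
    = \det (('X ^+ 2)%:M - 'X *: map_mx polyC A + map_mx polyC B).
Proof.
pose A' := map_mx polyC A; pose B' := map_mx polyC B.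
(* Right multiplication by the block matrix with rows (X, 0) and (1, 1), of determinant X^n, makes
   the characteristic matrix block upper triangular. The lower right block then contributes another
   X^n, and this factor cancels. *)
have Xn_reg : GRing.rreg ('X ^+ n : {poly F}).
  by apply/rregP; rewrite -size_poly_eq0 size_polyXn.
apply: Xn_reg; rewrite /char_poly /char_poly_mx.
have -> : map_mx polyC (block_mx A (- B) 1%:M 0) = block_mx A' (- B') 1%:M 0.
  by rewrite map_block_mx map_mx1 map_mx0 map_mxN.
have <- : \det (block_mx ('X%:M : 'M[{poly F}]_n) 0 1%:M 1%:M) = 'X ^+ n.
  by rewrite det_lblock det_scalar det1 mulr1.
rewrite -det_mulmx scalar_mx_block opp_block_mx add_block_mx mulmx_block.
rewrite !mulmx1 !add0r !subr0 opprK !mulmx0 !add0r mulNmx mul1mx addNr.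
rewrite det_ublock det_scalar det_lblock det_scalar det1 mulr1.
congr (\det _ * _).
by rewrite mulmxBl -scalar_mxM expr2 scalar_mxC mul_scalar_mx.
Qed.

(** Over [R[i]] a real symmetric matrix is Hermitian, so the spectral theorem applies; its
    eigenvalues are real, hence the real row [h]. *)
Lemma symmetric_spectrum (R : rcfType) (n : nat) (H : 'M[R]_n) : H^T = H ->
  exists2 P : 'M[R[i]]_n, P \in unitmx &
  exists h : 'rV[R]_n,
  map_mx (real_complex R) H
    = invmx P *m diag_mx (map_mx (real_complex R) h) *m P.
Proof.
move=> H_sym; pose HC := map_mx (real_complex R) H.
have HC_herm : HC \is hermsymmx.
  apply: realsym_hermsym.
    apply/is_hermitianmxP; rewrite expr0 scale1r.
    by apply/matrixP => i j; rewrite !mxE -[in LHS]H_sym mxE.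
  by apply/mxOverP => i j; rewrite mxE; apply/complex_realP; exists (H i j).
exists (spectralmx HC); first exact: spectral_unit.
exists (map_mx (@complex.Re R) (spectral_diag HC)).
rewrite [LHS](orthomx_spectralP (hermitian_normalmx HC_herm)) -/HC.
congr (_ *m diag_mx _ *m _); apply/matrixP => i j; rewrite !mxE RRe_real //.
exact: (mxOverP (hermitian_spectral_diag_real HC_herm)).
Qed.

Lemma eigenvalue_conj_diag (R : rcfType) (n : nat) (H : 'M[R]_n)
    (P : 'M[R[i]]_n) (h : 'rV[R]_n) (a : R) : P \in unitmx ->
  map_mx (real_complex R) H
    = invmx P *m diag_mx (map_mx (real_complex R) h) *m P ->
  eigenvalue H a <-> exists i, h 0 i = a.
Proof.
move=> P_unit HE.
have -> : eigenvalue H a = root (char_poly (map_mx (real_complex R) H)) a%:C%C.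
  by rewrite eigenvalue_root_char -(fmorph_root (real_complex R)) map_char_poly.
rewrite /char_poly /char_poly_mx HE -scaleN1r det_lin_comb_conj_diag //.
rewrite rootE horner_prod prodf_seq_eq0.
split=> [/hasP[i _ /=]|[i hi]].
  rewrite !mxE mulN1r !hornerE subr_eq0 => /eqP/complexI ->; by exists i.
apply/hasP; exists i; first by rewrite mem_index_enum.
by rewrite !mxE mulN1r !hornerE /= hi subrr.
Qed.

Lemma rank_kermx_conj_diag (R : rcfType) (n : nat) (H : 'M[R]_n)
    (P : 'M[R[i]]_n) (h : 'rV[R]_n) : P \in unitmx ->
  map_mx (real_complex R) H
    = invmx P *m diag_mx (map_mx (real_complex R) h) *m P ->
  \rank (kermx H) = #|[pred i | (h 0 i == 0)%R]|.
Proof.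
move=> P_unit HE; rewrite mxrank_ker -(mxrank_map (real_complex R)) HE.
rewrite mxrankMfree ?row_free_unit // eqmxMfull ?row_full_unit ?unitmx_inv //.
rewrite rank_diag_mx -cardC_ord; apply: eq_card => i.
by rewrite !inE negbK mxE fmorph_eq0.
Qed.

(** * Quadratics with both roots in a disk *)

(* The Schur-Cohn (Jury) region for [z ^+ 2 - b * z + c] and the disk of
   radius [r]; it is convex in (b, c). *)
Definition schur_region (R : realDomainType) (b c r : R) : Prop :=
  `|c| <= r ^+ 2 /\ `|b| * r <= r ^+ 2 + c.

Lemma normc_le (R : rcfType) (x y r : R) : 0 <= r ->
  (Normc.normc (Complex x y) <= r) = (x ^+ 2 + y ^+ 2 <= r ^+ 2).
Proof.
move=> r_ge0; rewrite /= -{1}[r]ger0_norm // -sqrtr_sqr ler_sqrt //.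
exact: sqr_ge0.
Qed.

Lemma schur_regionP (R : rcfType) (z1 z2 : R[i]) (b c r : R) : 0 < r ->
  z1 + z2 = b%:C%C -> z1 * z2 = c%:C%C ->
  (Normc.normc z1 <= r /\ Normc.normc z2 <= r) <-> schur_region b c r.
Proof.
case: z1 z2 => [x1 y1] [x2 y2] r_gt0 [xb yb] [xc yc].
have r_ge0 := ltW r_gt0; rewrite !normc_le // /schur_region.
have y2E : y2 = - y1 by lra.
rewrite {}y2E in xb xc yc *.
have sqr_bnd x : x ^+ 2 <= r ^+ 2 -> - r <= x <= r.
  move=> x_le; rewrite -ler_norml -(ler_pXn2r (_ : (0 < 2)%N)) ?nnegrE //.
  by rewrite real_normK ?num_real.
(* The imaginary part of the product vanishes, so the roots are either both real or complex
   conjugates. *)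
have /eqP : y1 * (x2 - x1) = 0 by nra.
rewrite mulf_eq0 => /orP[/eqP y10|/eqP x12].
  rewrite {}y10 in xb xc yc *; rewrite -{}xb -{}xc.
  split=> [[h1 h2]|[]].
    have /andP[? ?] : - r <= x1 <= r by apply: sqr_bnd; lra.
    have /andP[? ?] : - r <= x2 <= r by apply: sqr_bnd; lra.
    split; first by rewrite ler_norml; apply/andP; split; nra.
    by have [_|_] := ler0P (x1 + x2); nra.
  rewrite ler_norml => /andP[? ?] br.
  (* The two signs of [|b|] say that (r - x1)(r - x2) and (r + x1)(r + x2) are nonnegative. A root
     outside [-r, r] would force the other one to or beyond the same end, and the product would
     exceed r^2. *)
  have b1 : (x1 + x2) * r <= r ^+ 2 + (x1 * x2 - 0 * - 0).
    by apply: le_trans br; apply: ler_wpM2r => //; exact: ler_norm.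
  have b2 : - (x1 + x2) * r <= r ^+ 2 + (x1 * x2 - 0 * - 0).
    apply: le_trans br; apply: ler_wpM2r => //.
    by rewrite -normrN; exact: ler_norm.
  have bnd x y : x * y <= r ^+ 2 ->
      0 <= (r - x) * (r - y) -> 0 <= (r + x) * (r + y) ->
    x ^+ 2 + 0 ^+ 2 <= r ^+ 2.
    move=> xy_le minus plus.
    have x_le : x <= r.
      rewrite leNgt; apply/negP => x_gt.
      have y_ge : r <= y.
        by rewrite -subr_le0 -(nmulr_rge0 _ (_ : r - x < 0)) //; lra.
      have := ler_wpM2l r_ge0 y_ge; have := mulr_gt0 r_gt0 (_ : 0 < x - r).
      have := mulr_ge0 (_ : 0 <= x - r) (_ : 0 <= y - r); lra.
    have x_ge : - r <= x.
      rewrite leNgt; apply/negP => x_lt.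
      have y_le : r + y <= 0.
        by rewrite -(nmulr_rge0 _ (_ : r + x < 0)) //; lra.
      have := mulr_gt0 r_gt0 (_ : 0 < - (r + x)).
      have := mulr_ge0 r_ge0 (_ : 0 <= - (r + y)).
      have := mulr_ge0 (_ : 0 <= - (r + x)) (_ : 0 <= - (r + y)); lra.
    nra.
  split; first by apply: (bnd _ x2); nra.
  by rewrite sqrrN; apply: (bnd _ x1); nra.
(* For a conjugate pair, c is the squared modulus, so the bound on c decides; the bound on b follows
   from (r - |x1|)^2 + y1^2 >= 0. *)
have {x12} x2E : x2 = x1 by lra.
rewrite {}x2E in xb xc yc *; rewrite -{}xb -{}xc.
split=> [[h1 h2]|[]].
  split; first by rewrite ger0_norm; nra.
  by have [_|_] := ler0P (x1 + x1); nra.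
rewrite ler_norml => /andP[? ?] _; split; nra.
Qed.

(** * Optimality and uniqueness as polynomial inequalities *)

(** With u = m / (1 + t) the second condition becomes 2|u| <= 1 - t + u, that is, -(1 - t)/3 <= u <=
    1 - t. Both ends of the allowed range of [m] are therefore sharp. *)
Lemma schur_region_opt (R : realFieldType) (t beta m : R) : 0 < t -> t < 1 ->
  beta * (1 + t) = 1 - t -> - (1 - t ^+ 2) / 3 <= m -> m <= 1 - t ^+ 2 ->
  schur_region ((1 + beta) * m) (beta * m) (1 - t).
Proof.
move=> t0 t1 bE m1 m2.
have -> : beta = (1 - t) / (1 + t) by rewrite -bE; field; lra.
have i0 : 0 < (1 + t)^-1 by rewrite invr_gt0; lra.
have mE : m = (1 + t) * (m / (1 + t)) by field; lra.
set u := m / (1 + t) in mE.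
have -> : (1 + (1 - t) / (1 + t)) * m = 2 * u by rewrite /u; field; lra.
have -> : (1 - t) / (1 + t) * m = (1 - t) * u by rewrite /u; field; lra.
have u1 : - (1 - t) / 3 <= u by nra.
have u2 : u <= 1 - t by nra.
split; first by rewrite ler_norml; apply/andP; split; nra.
by have [_|_] := ler0P (2 * u); nra.
Qed.

(* With [a = 1 - alpha * l] and [b = 1 - alpha * L], the equation says that
   [L / l] is the condition number for which the rate [1 - t] is optimal. *)
Lemma schur_region_opt_unique (R : realFieldType) (t beta a b : R) :
  0 < t -> t < 1 -> a < 1 -> 3 * t ^+ 2 * (1 - b) = (4 - t ^+ 2) * (1 - a) ->
  schur_region ((1 + beta) * a) (beta * a) (1 - t) ->
  schur_region ((1 + beta) * b) (beta * b) (1 - t) ->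
  a = 1 - t ^+ 2 /\ beta * (1 + t) = 1 - t.
Proof.
move=> t0 t1 a1 kappaE [ca Ba] [cb Bb].
pose r := 1 - t; have r0 : 0 < r by rewrite /r; lra.
(* Only one sign of each absolute value is kept: plus at [a], minus at [b]. The coefficients come
   from r - 1 = -t and r + 1 = 2 - t. *)
have {Ba} A : a * (r - beta * t) <= r ^+ 2.
  have := le_trans (ler_wpM2r (ltW r0) (ler_norm _)) Ba; rewrite /r; lra.
have {Bb} B : - b * (r + beta * (2 - t)) <= r ^+ 2.
  rewrite -normrN in Bb.
  have := le_trans (ler_wpM2r (ltW r0) (ler_norm _)) Bb; rewrite /r; lra.
have C : beta * a <= r ^+ 2 := le_trans (ler_norm _) ca.
have D : beta * b <= r ^+ 2 := le_trans (ler_norm _) cb.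
clear ca cb.
(* For [beta] beyond the optimal value, [C] bounds [a] and [B] bounds [- b];
   between [- r / 2] and the optimum, [A] and [B] do; below [- r / 2], [A] and
   [D] do. *)
have [beta_ge|beta_lt] := leP r (beta * (1 + t)).
  have beta0 : 0 < beta by nra.
  have a_le : a <= r * (1 + t).
    rewrite -(ler_pM2l beta0); apply: le_trans C _; rewrite expr2.
    nra.
  (* The bound on [a] is carried over to [b] by [kappaE]. *)
  have Nb_ge : r * (1 + t) <= - b * 3.
    have x_ge : t ^+ 2 <= 1 - a by move: a_le; rewrite /r; lra.
    have : 3 * t ^+ 2 * (1 - b) >= (4 - t ^+ 2) * t ^+ 2.
      by rewrite kappaE ler_wpM2l //; nra.
    rewrite mulrAC -subr_ge0 => h.
    suff : 0 <= t ^+ 2 * (- b * 3 - r * (1 + t)).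
      by rewrite pmulr_rge0 ?exprn_gt0 // subr_ge0.
    by rewrite /r; lra.
  have Nb0 : 0 < - b by nra.
  (* At beta = r / (1 + t) the factor r + beta (2 - t) equals 3 r / (1 + t). A larger [beta] would
     make the left side of [B] exceed r^2. *)
  have bE : beta * (1 + t) = r.
    apply/eqP; rewrite eq_le beta_ge andbT leNgt; apply/negP => gt.
    have : 3 * r / (1 + t) < r + beta * (2 - t).
      rewrite ltr_pdivrMr; last by lra.
      rewrite /r in gt *; nra.
    rewrite -(ltr_pM2l Nb0) => /lt_le_trans/(_ B).
    rewrite ltNge => /negP; apply.
    rewrite mulrA ler_pdivlMr; last by lra.
    nra.
  split=> //; apply/eqP; rewrite eq_le; apply/andP; split.
    by move: a_le; rewrite /r; lra.
  (* With [beta] known, [B] bounds [- b] from above, and [kappaE] turns this into the missing lower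
     bound on [a]. *)
  have Nb_le : - b * 3 <= r * (1 + t).
    have betaE : beta = r / (1 + t) by rewrite -bE; field; lra.
    move: B; rewrite betaE.
    have -> : - b * (r + r / (1 + t) * (2 - t)) = (- b * 3) * (r / (1 + t)).
      by field; lra.
    have -> : r ^+ 2 = (r * (1 + t)) * (r / (1 + t)) by field; lra.
    by rewrite ler_pM2r // divr_gt0 //; lra.
  have b1 : 1 - b <= (4 - t ^+ 2) / 3 by move: Nb_le; rewrite /r; lra.
  have : (4 - t ^+ 2) * (1 - a) <= (4 - t ^+ 2) * t ^+ 2.
    by rewrite -kappaE; nra.
  rewrite ler_pM2l; first lra.
  by have : 0 < (2 - t) * (2 + t) by [rewrite mulr_gt0 //; lra]; lra.
exfalso.
have [beta_gt|beta_le] := ltP (- r) (2 * beta).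
  have p1 : 0 < r - beta * t by rewrite /r in beta_lt *; nra.
  have p2 : 0 < r + beta * (2 - t) by rewrite /r in beta_gt *; nra.
  have X : t * (r - beta) <= (1 - a) * (r - beta * t).
    by move: A; rewrite /r; lra.
  have Y : (1 - b) * (r + beta * (2 - t)) <= (2 - t) * (r + beta).
    by move: B; rewrite /r; lra.
  (* [kappaE] eliminates [a] and [b] from [X] and [Y], leaving an inequality in [t] and [beta]
     alone. Its left side minus its right side factors into terms that are all positive for [beta]
     strictly between - r / 2 and r / (1 + t). *)
  have G : (4 - t ^+ 2) * (t * (r - beta)) * (r + beta * (2 - t))
      <= 3 * t ^+ 2 * ((2 - t) * (r + beta)) * (r - beta * t).
    apply: (@le_trans _ _ ((4 - t ^+ 2) * ((1 - a) * (r - beta * t))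
        * (r + beta * (2 - t)))).
      by rewrite ler_pM2r // ler_pM2l //; nra.
    rewrite mulrA -kappaE.
    have -> : 3 * t ^+ 2 * (1 - b) * (r - beta * t) * (r + beta * (2 - t))
      = (3 * t ^+ 2 * (r - beta * t)) * ((1 - b) * (r + beta * (2 - t))).
      by ring.
    have -> : 3 * t ^+ 2 * ((2 - t) * (r + beta)) * (r - beta * t)
      = (3 * t ^+ 2 * (r - beta * t)) * ((2 - t) * (r + beta)) by ring.
    by rewrite ler_pM2l // !mulr_gt0 // exprn_gt0.
  have : 0 < t * (2 - t) * (2 * r * (r - (1 + t) * beta) * (2 * beta + r)).
    by rewrite !mulr_gt0 //; lra.
  suff : t * (2 - t) * (2 * r * (r - (1 + t) * beta) * (2 * beta + r))
    = (4 - t ^+ 2) * (t * (r - beta)) * (r + beta * (2 - t)) -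
      3 * t ^+ 2 * ((2 - t) * (r + beta)) * (r - beta * t) by move=> ->; lra.
  by rewrite /r; ring.
(* Here - beta >= r / 2; inserting this in [A] and [D] gives bounds free of [beta]. *)
have a_le : a * (2 + t) <= 2 * r.
  have [a_ge|] := leP 0 a; last by nra.
  rewrite -(ler_pM2r r0).
  have := mulr_ge0 (mulr_ge0 a_ge (ltW t0)) (_ : 0 <= - r - 2 * beta); lra.
have Nb_le : - b <= 2 * r.
  have [b_ge|] := leP b 0; last by lra.
  rewrite -(ler_pM2r r0).
  have := mulr_ge0 (_ : 0 <= - b) (_ : 0 <= - r - 2 * beta); lra.
have x_ge : 3 * t <= (1 - a) * (2 + t) by move: a_le; rewrite /r; lra.
have y_le : 1 - b <= 3 - 2 * t by move: Nb_le; rewrite /r; lra.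
have : (2 - t) * (3 * t) <= 3 * t ^+ 2 * (3 - 2 * t).
  apply: le_trans (_ : 3 * t ^+ 2 * (1 - b) <= _).
    rewrite kappaE; have -> : 4 - t ^+ 2 = (2 - t) * (2 + t) by ring.
    by rewrite -mulrA ler_wpM2l //; lra.
  by rewrite ler_wpM2l //; nra.
(* This is the left side minus the right side of the preceding inequality, hence the
   contradiction. *)
have : 0 < 6 * t * (1 - t) ^+ 2 by rewrite !mulr_gt0 ?exprn_gt0 //; lra.
lra.
Qed.

(** * From the convergence factor to conditions on Hessian eigenvalues *)

Lemma perm_eq_iter_rem (T : eqType) (x : T) (d : nat) (s rest : seq T) :
  perm_eq s (nseq d x ++ rest) -> perm_eq (iter d (rem x) s) rest.
Proof.
elim: d s => [//|d IHd] s s_perm; rewrite iterSr; apply: IHd.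
have x_s : x \in s by rewrite (perm_mem s_perm) mem_head.
by rewrite -(perm_cons x) -(permPl (perm_to_rem x_s)).
Qed.

(** The bound [0 <= r] takes care of the default value 0 of the maximum. *)
Lemma reduced_spectral_radius_le (R : realType) (d m : nat) (A : 'M[R]_m)
    (rest : seq R[i]) (r : R) : 0 <= r ->
  perm_eq (eigenvalues A) (nseq d 1 ++ rest) ->
  (reduced_spectral_radius d A <= r) <->
  (forall z, z \in rest -> Normc.normc z <= r).
Proof.
move=> r_ge0 /perm_eq_iter_rem rest_perm.
rewrite /reduced_spectral_radius; split.
  move=> max_le z z_rest; apply: le_trans max_le; apply: le_bigmax_seq => //.
  by rewrite (perm_mem rest_perm).
move=> z_le; rewrite big_seq; apply: bigmax_le => // z.
by rewrite (perm_mem rest_perm); exact: z_le.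
Qed.

Lemma eigenvalues_perm (R : realType) (m : nat) (A : 'M[R]_m) (s : seq R[i]) :
  char_poly (map_mx (real_complex R) A) = \prod_(z <- s) ('X - z%:P) ->
  perm_eq (eigenvalues A) s.
Proof.
move=> AE; rewrite /eigenvalues; case: closed_field_poly_normal => s' /= s'E.
apply: prod_XsubC_eq; rewrite -AE s'E.
by rewrite (monicP (char_poly_monic _)) scale1r.
Qed.

Lemma quadratic_roots (R : rcfType) (b c : R[i]) :
  exists z : R[i] * R[i], z.1 + z.2 = b /\ z.1 * z.2 = c.
Proof.
pose d := sqrtc (b ^+ 2 - 4 * c).
exists ((b + d) / 2, (b - d) / 2) => /=; split; first by field.
have -> : (b + d) / 2 * ((b - d) / 2) = (b ^+ 2 - d ^+ 2) / 4 by field.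
by rewrite sqr_sqrtc; field.
Qed.

(** The kernel dimension of the Hessian is the number of zero entries of [h], so deleting that many
    ones removes exactly one root from each factor with [h 0 i = 0] and leaves [beta]. Every other
    factor keeps both roots. *)
Lemma convergence_factor_leP (R : realType) (n : nat) (f : 'rV[R]_n -> R)
    (x : 'rV[R]_n) (alpha beta r : R) :
  differentiable (gradient f) x -> (Hessian f x)^T = Hessian f x -> 0 < r ->
  convergence_factor f alpha beta x <= r <->
  forall a, eigenvalue (Hessian f x) a ->
    if a == 0 then (`|beta| <= r : Prop)
    else schur_region ((1 + beta) * (1 - alpha * a))
           (beta * (1 - alpha * a)) r.
Proof.
move=> df H_sym r_gt0; have r_ge0 := ltW r_gt0.
rewrite /convergence_factor /sAA1_matrix.
rewrite (Jacobian_is_diff (is_diff_steepest_descent alpha df)).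
set H := Hessian f x in H_sym *; set M := block_mx _ _ _ _.
have [P P_unit [h HE]] := symmetric_spectrum H_sym.
pose m i := 1 - alpha * h 0 i.
(* For a zero eigenvalue the pair is ordered with 1 first, so that the deleted ones are first
   components. *)
have roots_exist i : exists z : R[i] * R[i],
    [/\ z.1 + z.2 = ((1 + beta) * m i)%:C%C, z.1 * z.2 = (beta * m i)%:C%C
      & h 0 i = 0 -> z = (1, beta%:C%C)].
  have [h0|h_neq0] := eqVneq (h 0 i) 0.
    exists (1, beta%:C%C); rewrite /m h0 mulr0 subr0 !mulr1 /=.
    by rewrite mul1r rmorphD rmorph1.
  have [z [zD zM]] :=
    quadratic_roots ((1 + beta) * m i)%:C%C (beta * m i)%:C%C.
  by exists z; split=> // h0; rewrite h0 eqxx in h_neq0.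
have /boolp.choice[z zP] := roots_exist.
pose e := index_enum 'I_n.
pose rest := [seq (z i).1 | i <- e & h 0 i != 0] ++ [seq (z i).2 | i <- e].
have eig_perm : perm_eq (eigenvalues M)
    ([seq (z i).1 | i <- e] ++ [seq (z i).2 | i <- e]).
  apply: eigenvalues_perm; rewrite big_cat /= !big_map -big_split /=.
  rewrite /M map_block_mx map_mx0 !map_mxZ map_mxB !map_mx1 map_mxZ HE.
  rewrite rmorphN scaleNr.
  rewrite char_poly_second_order.
  set D := invmx P *m _ *m P.
  pose k : R[i] := (1 + beta)%:C%C; pose b : R[i] := beta%:C%C.
  pose a : R[i] := alpha%:C%C.
  (* Both coefficients of the quadratic matrix polynomial are affine in [D], which brings it to the
     form required by [det_lin_comb_conj_diag]. *)
  have -> : ('X ^+ 2)%:M - 'X *: map_mx polyC (k *: (1%:M - a *: D))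
        + map_mx polyC (b *: (1%:M - a *: D))
      = ('X ^+ 2 - k *: 'X + b%:P)%:M
        + (a *: (k *: 'X - b%:P)) *: map_mx polyC D.
    rewrite !map_mxZ !map_mxB !map_mxZ map_mx1.
    apply/matrixP => i j; rewrite !mxE -!mul_polyC.
    by case: (i == j); rewrite ?mulr1n ?mulr0n; ring.
  rewrite det_lin_comb_conj_diag //; apply: eq_bigr => i _; rewrite mxE.
  have [zD zM _] := zP i.
  have -> : ('X - (z i).1%:P) * ('X - (z i).2%:P)
      = 'X ^+ 2 - ((z i).1 + (z i).2)%:P * 'X + ((z i).1 * (z i).2)%:P.
    by rewrite polyCD polyCM; ring.
  have mE : (m i)%:C%C = 1 - a * (h 0 i)%:C%C.
    by rewrite rmorphB rmorph1 rmorphM.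
  have bE : ((1 + beta) * m i)%:C%C = k * (1 - a * (h 0 i)%:C%C).
    by rewrite -mE -rmorphM.
  have cE : (beta * m i)%:C%C = b * (1 - a * (h 0 i)%:C%C).
    by rewrite -mE -rmorphM.
  rewrite zD zM bE cE -!mul_polyC.
  by rewrite !(polyCM, polyCB) polyC1; ring.
have {}eig_perm : perm_eq (eigenvalues M) (nseq (\rank (kermx H)) 1 ++ rest).
  apply: perm_trans eig_perm _; rewrite catA perm_cat2r.
  rewrite (rank_kermx_conj_diag P_unit HE).
  have -> : nseq #|[pred i | (h 0 i == 0)%R]| 1
      = [seq (z i).1 | i <- e & h 0 i == 0].
    have /all_pred1P -> : all (pred1 1) [seq (z i).1 | i <- e & h 0 i == 0].
      rewrite all_map; apply/allP => i.
      rewrite mem_filter => /andP[/eqP h0 _] /=.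
      by have [_ _ ->] := zP i.
    by rewrite size_map -sum1_size big_filter -sum1_card.
  rewrite -map_cat perm_map // perm_sym; apply: permEl.
  exact: (perm_filterC (fun i => h 0 i == 0)).
rewrite (reduced_spectral_radius_le r_ge0 eig_perm); split.
  move=> rest_le a /(eigenvalue_conj_diag a P_unit HE)[i <-].
  have z2_le : Normc.normc (z i).2 <= r.
    apply: rest_le; rewrite mem_cat; apply/orP; right.
    by apply/mapP; exists i; rewrite ?mem_index_enum.
  have [zD zM z0] := zP i.
  case: eqVneq => [h0|h_neq0].
    by move: z2_le; rewrite z0 //= expr0n addr0 sqrtr_sqr.
  apply/(schur_regionP r_gt0 zD zM); split=> //; apply: rest_le.
  rewrite mem_cat; apply/orP; left.
  by apply/mapP; exists i; rewrite // mem_filter h_neq0 mem_index_enum.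
move=> reg w.
have {}reg i := reg _
  ((eigenvalue_conj_diag _ P_unit HE).2 (ex_intro _ i erefl)).
have z_le i : h 0 i != 0 ->
    Normc.normc (z i).1 <= r /\ Normc.normc (z i).2 <= r.
  have := reg i; case: eqVneq => // _ reg_i _; have [zD zM _] := zP i.
  exact/(schur_regionP r_gt0 zD zM).
rewrite mem_cat => /orP[] /mapP[i + ->].
  by rewrite mem_filter => /andP[/z_le[]].
move=> _; have := reg i; have := z_le i; case: eqVneq => [h0 _|_ /(_ isT)[]//].
by have [_ _ ->] := zP i; rewrite //= expr0n addr0 sqrtr_sqr.
Qed.

(** * The optimal parameters and the optimal rate *)

Theorem theorem3p4 (R : realType) (n : nat) (f : 'rV[R]_n -> R)
    (xs : 'rV[R]_n) (L l : R)
    (f_C2 : twice_continuously_differentiable f)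
    (grad_xs : gradient f xs = 0)
    (H_psd : positive_semidefinite (Hessian f xs))
    (L_largest : largest_eigenvalue (Hessian f xs) L)
    (l_smallest : smallest_nonzero_eigenvalue (Hessian f xs) l)
    (l_lt_L : l < L) (l_gt0 : 0 < l) :
  let kappa := L / l in
  let s := Num.sqrt (3 * kappa + 1) in
  let rho (alpha beta : R) := convergence_factor f alpha beta xs in
  let alpha_opt := 4 / (3 * L + l) in
  let beta_opt :=
    (1 - Num.sqrt (alpha_opt * l)) / (1 + Num.sqrt (alpha_opt * l)) in
  let rho_opt := (s - 2) / s in
  (* the setting: q'(xs) = I - alpha H, and T is the Jacobian of the system *)
  (forall alpha beta : R, 0 < alpha ->
     [/\ Jacobian (steepest_descent f alpha) xs
           = 1%:M - alpha *: Hessian f xs,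
         differentiable (sAA1_system f alpha beta) (row_mx xs xs)
       & Jacobian (sAA1_system f alpha beta) (row_mx xs xs)
           = sAA1_matrix f alpha beta xs]) /\
  (* rho_opt is the minimum, attained only at (alpha_opt, beta_opt) *)
  [/\ 0 < alpha_opt,
      rho alpha_opt beta_opt = rho_opt,
      forall alpha beta : R, 0 < alpha -> rho_opt <= rho alpha beta
    & forall alpha beta : R, 0 < alpha -> rho alpha beta = rho_opt ->
        alpha = alpha_opt /\ beta = beta_opt] /\
  [/\ rho_opt = 1 - Num.sqrt (4 * l / (3 * L + l)),
      1 - Num.sqrt (4 * l / (3 * L + l)) < 1 - Num.sqrt (l / L)
    & beta_opt = (s - 2) / (s + 2)].
Proof.
move=> kappa s rho alpha_opt beta_opt rho_opt.
have [_ /(_ xs) dg _] := f_C2; have [H_sym _] := H_psd.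
have [L_eig L_max] := L_largest; have [l_eig _ l_min] := l_smallest.
have L_gt0 : 0 < L by apply: lt_trans l_lt_L.
have den_gt0 : 0 < 3 * L + l by lra.
have alpha_gt0 : 0 < alpha_opt by rewrite divr_gt0.
pose t := Num.sqrt (4 * l / (3 * L + l)).
have tE : Num.sqrt (alpha_opt * l) = t by rewrite /alpha_opt mulrAC.
have t2E : t ^+ 2 = 4 * l / (3 * L + l).
  by rewrite sqr_sqrtr // divr_ge0 //; lra.
have t2_al : t ^+ 2 = alpha_opt * l by rewrite t2E /alpha_opt mulrAC.
have t_gt0 : 0 < t by rewrite sqrtr_gt0 divr_gt0 //; lra.
have t_lt1 : t < 1.
  rewrite -(ltr_pXn2r (_ : (0 < 2)%N)) ?nnegrE ?ltW //.
  by rewrite expr1n t2E ltr_pdivrMr //; lra.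
(* Since 3 kappa + 1 = 4 / t^2, all closed forms become rational in [t]. *)
have sE : s = 2 / t.
  have -> : s = Num.sqrt ((2 / t) ^+ 2).
    congr Num.sqrt; rewrite expr_div_n t2E /kappa; field.
    by rewrite !lt0r_neq0.
  by rewrite sqrtr_sqr gtr0_norm // divr_gt0.
have t1_neq0 : 1 + t != 0 by rewrite lt0r_neq0 // addr_gt0.
have l_neq0 := lt0r_neq0 l_gt0.
have den_neq0 := lt0r_neq0 den_gt0.
have t_neq0 := lt0r_neq0 t_gt0.
have rho_optE : rho_opt = 1 - t by rewrite /rho_opt sE; field.
have beta_optE : beta_opt = (1 - t) / (1 + t) by rewrite /beta_opt tE.
have beta_optM : beta_opt * (1 + t) = 1 - t by rewrite beta_optE divfK.
have rho_gt0 : 0 < rho_opt by rewrite rho_optE subr_gt0.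
have al_l : 1 - alpha_opt * l = 1 - t ^+ 2 by rewrite t2_al.
(* The extreme eigenvalues [l] and [L] land exactly on the two ends of the interval in
   [schur_region_opt]. *)
have al_L : 1 - alpha_opt * L = - (1 - t ^+ 2) / 3.
  by rewrite t2E /alpha_opt; field.
have rho_le : rho alpha_opt beta_opt <= rho_opt.
  apply/(convergence_factor_leP _ _ dg H_sym rho_gt0) => a a_eig.
  rewrite rho_optE; case: eqVneq => [_|a_neq0].
    have b_gt0 : 0 < beta_opt by rewrite beta_optE; apply: divr_gt0; lra.
    rewrite gtr0_norm // -beta_optM; nra.
  have a_le : alpha_opt * a <= alpha_opt * L by rewrite ler_pM2l // L_max.
  have a_ge : alpha_opt * l <= alpha_opt * a by rewrite ler_pM2l // l_min.
  by apply: schur_region_opt => //; lra.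
(* The conditions at [l] and [L] alone determine both parameters. *)
have uniq alpha beta : 0 < alpha -> rho alpha beta <= rho_opt ->
    alpha = alpha_opt /\ beta = beta_opt.
  move=> a_gt0 /(convergence_factor_leP _ _ dg H_sym rho_gt0) reg.
  have := reg L L_eig; have := reg l l_eig; rewrite !gt_eqF // rho_optE.
  move=> reg_l reg_L.
  have [] := @schur_region_opt_unique R t beta (1 - alpha * l) (1 - alpha * L)
    t_gt0 t_lt1 _ _ reg_l reg_L.
  - by have := mulr_gt0 a_gt0 l_gt0; lra.
  - by rewrite t2E; field.
  rewrite t2_al => alE bE; split.
    by apply: (mulIf (lt0r_neq0 l_gt0)); lra.
  by rewrite beta_optE -bE mulfK.
(* At the optimum the double root for [l] has product [rho_opt ^+ 2]. *)
have rho_ge : rho_opt <= rho alpha_opt beta_opt.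
  rewrite leNgt; apply/negP => rho_lt.
  (* The criterion needs a positive radius, while the factor itself is only known to lie below
     [rho_opt]; the maximum with [rho_opt / 2] is positive and still below [rho_opt]. *)
  pose r := Num.max (rho alpha_opt beta_opt) (rho_opt / 2).
  have r_gt0 : 0 < r by rewrite lt_max divr_gt0 ?orbT.
  have r_lt : r < rho_opt by rewrite gt_max rho_lt /=; lra.
  have : rho alpha_opt beta_opt <= r by rewrite le_max lexx.
  move=> /(convergence_factor_leP _ _ dg H_sym r_gt0)/(_ l l_eig).
  rewrite gt_eqF // => -[+ _]; rewrite al_l.
  have -> : beta_opt * (1 - t ^+ 2) = rho_opt ^+ 2.
    have -> : beta_opt * (1 - t ^+ 2) = beta_opt * (1 + t) * (1 - t) by ring.
    by rewrite beta_optM rho_optE expr2.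
  rewrite ger0_norm ?sqr_ge0 // leNgt => /negP; apply.
  by rewrite ltr_pXn2r // nnegrE ltW.
split.
  move=> alpha beta _; split.
  - exact: Jacobian_is_diff (is_diff_steepest_descent alpha dg).
  - by have [] := is_diff_sAA1_system alpha beta dg.
  - exact: Jacobian_is_diff (is_diff_sAA1_system alpha beta dg).
split; split.
- exact: alpha_gt0.
- by apply: le_anti; rewrite rho_le rho_ge.
(* A strictly smaller factor would, by [uniq], occur at the optimal parameters, against [rho_ge]. *)
- move=> alpha beta a_gt0; rewrite leNgt; apply/negP => rho_lt.
  have [aE bE] := uniq _ _ a_gt0 (ltW rho_lt).
  by move: rho_lt; rewrite aE bE ltNge rho_ge.
- by move=> alpha beta a_gt0 rhoE; apply: uniq; rewrite ?rhoE.
- exact: rho_optE.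
(* After clearing denominators the inequality is l (3 L + l) < 4 l L, that is, l < L. *)
- rewrite ltrD2l ltrN2 ltr_sqrt; last by rewrite divr_gt0 //; lra.
  by rewrite ltr_pdivrMr // mulrAC ltr_pdivlMr //; nra.
- rewrite beta_optE sE; field.
  by rewrite t_neq0 t1_neq0 lt0r_neq0 // addr_gt0 // mulr_gt0.
Qed.
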